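(* Let $m\ge2$ and let $\mathcal F=\mathcal F_\Theta$, $\mathcal F(x)=W_2\,\mathrm{Relu}(W_1x+b_1)+b_2$, with $W_1\in\mathbb R^{n_1\times n}$, $b_1\in\mathbb R^{n_1}$, $W_2\in\mathbb R^{m\times n_1}$, $b_2\in\mathbb R^m$, $\Theta=\{W_1,b_1,W_2,b_2\}$, be a (trained) network, and let $S\subset[0,1]^n$ be the set of normal samples, which are distributed according to $D_x$. Let $a,A,b,c$ be positive reals and $\eta\in(0,1)$ such that: ($C_1$) $|\mathcal F_i(x)-\mathcal F_j(x)|<A$ for all $i,j\in[m]$ and all $x\in\bigcup_{x_0\in S}S_\infty(x_0,a)$; ($C_2$) $\|W_2^{(i)}-W_2^{(j)}\|_{-\infty}>c$ for all $i,j\in[m]$ with $i\ne j$; ($C_3$) for all $x\in S$, at least $\eta n_1$ coordinates of $|\mathrm{Relu}(W_1x+b_1)|$ are bigger than $b$; ($C_4$) the dimension of (the linear span of) $S$ is lower than $n-m$. Let $\epsilon,\gamma$ be positive reals with $\epsilon<a$. If $$n_1>\frac{2A}{\min\{\epsilon\gamma/m,\,b\}\,c\,\eta},$$ then there exists $\mathcal F_{\Theta_a}\in\mathcal H_\gamma(\Theta)$ such that the accuracy of $\mathcal F_{\Theta_a}$ over $D_x$ is greater than or equal to that of $\mathcal F_\Theta$ and $$P_{x\sim D_x}\big(\mathcal F_{\Theta_a}\text{ has an adversarial sample of }x\text{ in }S_\infty(x,\epsilon)\big)\ge 0.5 .$$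
   Context: $[m]=\{1,\dots,m\}$. $\mathrm{Relu}(t)=\max\{t,0\}$ is applied coordinatewise. $\mathcal F_i(x)$ is the $i$-th coordinate of $\mathcal F(x)$; $\widehat{\mathcal F}(x)\in[m]$ is the classification result (label) of $\mathcal F$ at $x$, i.e. the index of the largest coordinate of $\mathcal F(x)$. The formula defining the network is evaluated at any point of $\mathbb R^n$. $D_x$ is a probability distribution of samples supported on $S$; each sample $x$ has a true label $l_x\in[m]$. The accuracy of $\mathcal F$ over $D_x$ is $P_{x\sim D_x}(\widehat{\mathcal F}(x)=l_x)$. $W^{(i)}$ is the $i$-th row of a matrix $W$; for a vector $x$, $\|x\|_{-\infty}=\min_i|x_i|$. $S_\infty(x_0,\epsilon)=\{x\in\mathbb R^n:\|x-x_0\|_\infty\le\epsilon\}$. $\mathcal H_\gamma(\Theta)=\{\mathcal F_{\Theta_a}:\|\Theta_a-\Theta\|_\infty<\gamma\}$ is the set of networks of the same architecture whose parameters (weights and biases) differ from $\Theta$ entrywise by less than $\gamma$. An adversarial sample of $x$ in $S_\infty(x,\epsilon)$ for a network $\mathcal G$ is a point $x'\in S_\infty(x,\epsilon)$ with $\widehat{\mathcal G}(x')\ne l_x$. *)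

(* Defs.v *)
From HB Require Import structures.
From mathcomp Require Import all_boot all_order all_algebra.
From mathcomp Require Import all_classical all_reals all_analysis.

Set Implicit Arguments.
Unset Strict Implicit.
Unset Printing Implicit Defensive.

Import Order.TTheory GRing.Theory Num.Theory.
Import numFieldNormedType.Exports.

Local Open Scope classical_set_scope.
Local Open Scope ring_scope.

(* R^n with its Borel sigma-algebra; convertible to 'cV[R]_n. *)
Definition borelRn (R : realType) (n : nat) :=
  g_sigma_algebraType (@open 'cV[R]_n).

Record params (R : realType) (n n1 m : nat) := Params {
  W1 : 'M[R]_(n1, n);
  b1 : 'cV[R]_n1;
  W2 : 'M[R]_(m, n1);
  b2 : 'cV[R]_m }.

Definition relu (R : realType) (k : nat) (v : 'cV[R]_k) : 'cV[R]_k :=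
  map_mx (fun t => Num.max t 0) v.

Definition hidden (R : realType) (n n1 m : nat) (T : params R n n1 m)
    (x : 'cV[R]_n) : 'cV[R]_n1 :=
  relu (W1 T *m x + b1 T).

Definition network (R : realType) (n n1 m : nat) (T : params R n n1 m)
    (x : 'cV[R]_n) : 'cV[R]_m :=
  W2 T *m hidden T x + b2 T.

(* Ties are broken towards the least index, so at most one index qualifies;
   the value is None only when m = 0. *)
Definition classify (R : realType) (m : nat) (v : 'cV[R]_m) : option 'I_m :=
  [pick i | [forall j : 'I_m,
    (v j 0 < v i 0) || ((v j 0 == v i 0) && (i <= j)%N)]].

Definition Sinf (R : realType) (n : nat) (x0 : 'cV[R]_n) (r : R) :
    set 'cV[R]_n :=
  [set x | forall i, `|x i 0 - x0 i 0| <= r].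

(* min_i |v_i|, taken in the extended reals: +oo for the empty vector. *)
Definition norm_minf (R : realType) (k : nat) (v : 'rV[R]_k) : \bar R :=
  \big[Order.min/+oo%E]_(i < k) (`|v 0 i|)%:E.

Definition param_near (R : realType) (n n1 m : nat) (gamma : R)
    (T Ta : params R n n1 m) : Prop :=
  [/\ forall i j, `|W1 Ta i j - W1 T i j| < gamma,
      forall i, `|b1 Ta i 0 - b1 T i 0| < gamma,
      forall i j, `|W2 Ta i j - W2 T i j| < gamma &
      forall i, `|b2 Ta i 0 - b2 T i 0| < gamma].

Definition Hgamma (R : realType) (n n1 m : nat) (gamma : R)
    (T : params R n n1 m) : set ('cV[R]_n -> 'cV[R]_m) :=
  [set network Ta | Ta in [set Ta | param_near gamma T Ta]].

(* The smallest subspace containing S; see linear_spanP. *)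
Definition linear_span (R : realType) (n : nat) (S : set 'cV[R]_n) :
    {vspace 'cV[R]_n} :=
  xget 0%VS [set U : {vspace 'cV[R]_n} | (forall x, S x -> x \in U) /\
    forall V : {vspace 'cV[R]_n}, (forall x, S x -> x \in V) -> (U <= V)%VS].

Lemma linear_spanP (R : realType) (n : nat) (S : set 'cV[R]_n) :
  (forall x, S x -> x \in linear_span S) /\
  forall V : {vspace 'cV[R]_n},
    (forall x, S x -> x \in V) -> (linear_span S <= V)%VS.
Proof.
rewrite /linear_span; case: xgetP => [U _ //|noU].
pose P k := `[< exists2 U : {vspace 'cV[R]_n},
  (forall x, S x -> x \in U) & \dim U = k >].
have exP : exists k, P k.
  by exists (\dim {:'cV[R]_n}); apply/asboolP; exists fullv => // x _;
    rewrite memvf.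
case: (ex_minnP exP) => k /asboolP[U SU dU] kmin.
case: (noU U); split => // V SV.
have/kmin : P (\dim (U :&: V)%VS).
  by apply/asboolP; exists (U :&: V)%VS => // x Sx; rewrite memv_cap SU ?SV.
rewrite -dU => dUV; apply/capv_idPl/eqP.
by rewrite eqEdim capvSl.
Qed.

Definition accuracy (R : realType) (n m : nat)
    (D : probability (borelRn R n) R) (l : 'cV[R]_n -> 'I_m)
    (F : 'cV[R]_n -> 'cV[R]_m) : \bar R :=
  D [set x | classify (F x) = Some (l x)].

Definition adversarial_sample (R : realType) (n m : nat)
    (l : 'cV[R]_n -> 'I_m) (F : 'cV[R]_n -> 'cV[R]_m) (eps : R)
    (x x' : 'cV[R]_n) : Prop :=
  Sinf x eps x' /\ classify (F x') <> Some (l x).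

(* Main.v *)
Require Import Defs.
From HB Require Import structures.
From mathcomp Require Import all_boot all_order all_algebra.
From mathcomp Require Import all_classical all_reals all_analysis.
From mathcomp Require Import ring lra zify.

Set Implicit Arguments.
Unset Strict Implicit.
Unset Printing Implicit Defensive.

Import Order.TTheory GRing.Theory Num.Theory.
Import numFieldNormedType.Exports.

Local Open Scope classical_set_scope.
Local Open Scope ring_scope.

(* Since S spans a space of codimension at least m, there are m linear forms
   V_i vanishing on S; they can be normalised to have coefficients in [-1, 1]
   and to be dual to m basis vectors e_(f i). Adding to W1 the matrix s M,
   where s = 1 or -1 and M = (t/eps) sum_i p_i V_i with p_i the vector of
   signs of W2_(o i) - W2_i for some o i <> i, leaves the network unchanged
   on S, so the accuracy is preserved, whereas at x + s eps e_(f i) it moves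
   every pre-activation by t in the direction that raises output (o i) against
   output i.
   The neurons active at x need not be active at x + s eps e_(f i), but as
   pre-activations are affine each of them stays above b for s = 1 or for
   s = -1. Hence for one of the two signs at least half of them do, and the
   gain, at least c t eta n1 / 2 >= A, makes the label i = l x wrong. So every
   x in S has an adversarial sample for one of the two perturbed networks, and
   one of these two networks has adversarial samples with probability at least
   1/2. *)

(** * Continuity of the network outputs *)

Section Continuity.
Variable R : realType.

Lemma continuous_mx (T : topologicalType) (p q : nat) (f : T -> 'M[R]_(p, q)) :
  (forall i j, continuous (fun x => f x i j)) -> continuous f.
Proof.
move=> fc x; apply/cvg_ballP => e e0.
have H : \forall y \near x, forall ij : 'I_p * 'I_q,
    ball (f x ij.1 ij.2) e (f y ij.1 ij.2).
  apply: filter_forall => -[i j] /=.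
  by have /cvg_ballP/(_ _ e0) := fc i j x.
near=> y; split=> // i j.
exact: (near H y _ (i, j)).
Unshelve. all: by end_near. Qed.

Lemma continuous_sumr (T : topologicalType) (I : finType) (f : I -> T -> R) :
  (forall i, continuous (f i)) -> continuous (fun x => \sum_i f i x).
Proof.
move=> fc x; apply: cvg_big => [|i _]; first exact: add_continuous.
exact: fc.
Qed.

Lemma continuous_addr (T : topologicalType) (f g : T -> R) :
  continuous f -> continuous g -> continuous (fun x => f x + g x).
Proof. by move=> fc gc x; apply: (@cvgD _ _ _ _ _ f g); [exact: fc|exact: gc]. Qed.

Lemma continuous_scaler (T : topologicalType) (k : R) (f : T -> R) :
  continuous f -> continuous (fun x => k * f x).
Proof.
by move=> fc x; apply: (@cvgM _ _ _ _ (fun=> k) f); [exact: cvg_cst|exact: fc].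
Qed.

Lemma continuous_relur (T : topologicalType) (f : T -> R) :
  continuous f -> continuous (fun x => Num.max (f x) 0).
Proof.
move=> fc x.
by apply: (@continuous_max _ _ f (fun=> 0)); [exact: fc|exact: cvg_cst].
Qed.

Lemma continuous_network (n n1 m : nat) (T : params R n n1 m) (i : 'I_m) :
  continuous (fun x : 'cV[R]_n => network T x i 0).
Proof.
have -> : (fun x : 'cV[R]_n => network T x i 0) =
    fun x => \sum_k (W2 T i k *
      Num.max (\sum_j (W1 T k j * x j 0) + b1 T k 0) 0) + b2 T i 0.
  apply/funext => x; rewrite /network !mxE; congr (_ + _).
  by apply: eq_bigr => k _; rewrite !mxE.
apply: continuous_addr; last exact: cst_continuous.
apply: continuous_sumr => k; apply: continuous_scaler.
apply: continuous_relur; apply: continuous_addr; last exact: cst_continuous.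
by apply: continuous_sumr => j; apply: continuous_scaler; exact: coord_continuous.
Qed.

End Continuity.

(** * Borel sets defined by continuous functions and sup-norm balls *)

Section Measurability.
Variables (R : realType) (n : nat).

Lemma open_measurable_Rn (A : set 'cV[R]_n) :
  open A -> measurable (A : set (borelRn R n)).
Proof. exact: sub_gen_smallest. Qed.

Lemma measurable_gt (h : 'cV[R]_n -> R) (r : R) : continuous h ->
  measurable ([set x | r < h x] : set (borelRn R n)).
Proof.
move=> hc; apply: open_measurable_Rn.
by move/continuousP : hc => /(_ [set y | r < y]); apply; exact: open_gt.
Qed.

Lemma measurable_ge (h : 'cV[R]_n -> R) (r : R) : continuous h ->
  measurable ([set x | r <= h x] : set (borelRn R n)).
Proof.
move=> hc.
have -> : [set x | r <= h x] = ~` [set x | - r < - h x].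
  by apply/seteqP; split => x /=; rewrite ltrN2 leNgt => /negP.
apply: measurableC; apply: (@measurable_gt (fun x => - h x)).
by move=> x; apply: continuousN; exact: hc.
Qed.

Lemma continuous_shift_Rn (y : 'cV[R]_n) :
  continuous (fun x : 'cV[R]_n => x + y).
Proof.
apply: continuous_mx => i j x.
rewrite (_ : (fun z : 'cV[R]_n => (z + y) i j) = fun z : 'cV[R]_n => z i j + y i j).
  exact: (continuous_addr (@coord_continuous _ _ _ i j)
    (@cst_continuous _ _ _)).
by apply/funext => z; rewrite mxE.
Qed.

Lemma Sinf_center (x : 'cV[R]_n) (r : R) : 0 <= r -> Sinf x r x.
Proof. by move=> r0 i; rewrite subrr normr0. Qed.

(** Such a set is open: it is the union, over displacements [d] in the ball around 0, of the
    translates by [-d] of one open set. *)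
Lemma measurable_exists_gt (h : 'cV[R]_n -> R) (r s : R) : continuous h ->
  measurable ([set x | exists2 x', Sinf x r x' & s < h x'] : set (borelRn R n)).
Proof.
move=> hc; apply: open_measurable_Rn.
have -> : [set x | exists2 x', Sinf x r x' & s < h x'] =
    \bigcup_(d in Sinf 0 r) [set x | s < h (x + d)].
  apply/seteqP; split => [x [x' xx' sx']|x [d d0r sd]].
    exists (x' - x) => [i|/=]; last by rewrite addrC subrK.
    by have := xx' i; rewrite !mxE subr0.
  exists (x + d) => // i; have := d0r i.
  by rewrite !mxE subr0 addrAC subrr add0r.
apply: bigcup_open => d _.
have /continuousP/(_ [set y | s < y]) : continuous (fun x : 'cV[R]_n => h (x + d)).
  move=> x; apply: (@continuous_comp _ _ _ (fun x : 'cV[R]_n => x + d) h).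
    exact: continuous_shift_Rn.
  exact: hc.
by apply; exact: open_gt.
Qed.

(** The ball is a product of segments, hence compact; transposing presents it as a set of row
    vectors, the form [rV_compact] deals with. *)
Lemma Sinf_EVT_max (h : 'cV[R]_n -> R) (x : 'cV[R]_n) (r : R) :
  0 <= r -> continuous h ->
  exists2 y, Sinf x r y & forall z, Sinf x r z -> h z <= h y.
Proof.
move=> r0 hc.
pose B : set 'rV[R]_n :=
  [set v | forall i, `[x i 0 - r, x i 0 + r]%classic (v ord0 i)].
have BP (v : 'rV[R]_n) : B v <-> Sinf x r v^T.
  split=> H i; have := H i; rewrite /= in_itv /= mxE ler_distl //.
have Bc : compact B.
  exact: (@rV_compact R n (fun i => `[x i 0 - r, x i 0 + r]%classic)
    (fun i => @segment_compact _ _ _)).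
have [||y yB ymax] := @compact_EVT_max _ R (fun v : 'rV[R]_n => h v^T) B _ Bc.
- by exists x^T; apply/BP; rewrite trmxK; exact: Sinf_center.
- apply: continuous_subspaceT => v.
  apply: (@continuous_comp _ _ _ (fun v : 'rV[R]_n => v^T) h); last exact: hc.
  apply: continuous_mx => i j {}v.
  rewrite (_ : (fun z : 'rV[R]_n => z^T i j) = fun z : 'rV[R]_n => z j i).
    exact: coord_continuous.
  by apply/funext => z; rewrite mxE.
exists y^T; first by apply/BP; rewrite inE in yB.
move=> z zx; have := ymax z^T; rewrite trmxK; apply.
by rewrite inE; apply/BP; rewrite trmxK.
Qed.

(* By compactness of the ball, the condition [s <= h x'] for some [x'] is the
   countable intersection of the open conditions [s - 1/(k+1) < h x']. *)
Lemma measurable_exists_ge (h : 'cV[R]_n -> R) (r s : R) :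
  0 <= r -> continuous h ->
  measurable ([set x | exists2 x', Sinf x r x' & s <= h x'] : set (borelRn R n)).
Proof.
move=> r0 hc.
have -> : [set x | exists2 x', Sinf x r x' & s <= h x'] =
    \bigcap_k [set x | exists2 x', Sinf x r x' & s - k.+1%:R^-1 < h x'].
  apply/seteqP; split => [x [x' xx' sx'] k _|x H].
    by exists x' => //; rewrite (lt_le_trans _ sx') // gtrBl invr_gt0.
  have [y xy ymax] := Sinf_EVT_max x r0 hc.
  exists y => //; apply/ler_addgt0Pl => e e0.
  have [k ke] : exists k : nat, k.+1%:R^-1 < e.
    exists (Num.truncn e^-1); rewrite invf_plt ?posrE //.
    exact: truncnS_gt.
  have [x' xx' sx'] := H k I.
  rewrite -lerBlDl (le_trans _ (ymax _ xx')) // ltW // (le_lt_trans _ sx') //.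
  by rewrite lerD2l lerN2 ltW.
by apply: bigcapT_measurable => k; exact: measurable_exists_gt.
Qed.

End Measurability.

(** * Measurability of the accuracy and adversarial events *)

Section Classification.
Variables (R : realType) (m : nat).

Lemma classifyP (v : 'cV[R]_m) (i : 'I_m) :
  classify v = Some i <->
  forall j : 'I_m, (v j 0 < v i 0) || ((v j 0 == v i 0) && (i <= j)%N).
Proof.
rewrite /classify; case: pickP => [k /forallP kmax|none]; last first.
  by split=> // /forallP; rewrite none.
split=> [[<-] //|imax]; congr Some; apply: val_inj; apply/eqP => /=.
have := kmax i; have := imax k; rewrite eqn_leq.
by case: ltgtP => //= _ -> ->.
Qed.

Lemma classify_neq (v : 'cV[R]_m) (i j : 'I_m) :
  v i 0 < v j 0 -> classify v <> Some i.
Proof. by move=> ij /classifyP/(_ j); rewrite ltNge (ltW ij) gt_eqF. Qed.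

(** Ties go to the least index, so a competitor [j < i] beats [i] already by equality, while [j > i]
    must be strictly larger; [j = i] falls in the strict case, which then fails. Each alternative is
    an open or closed condition on one continuous difference of outputs. *)
Lemma classify_neqP (v : 'cV[R]_m) (i : 'I_m) :
  classify v <> Some i <-> exists j : 'I_m,
    if (i <= j)%N then 0 < v j 0 - v i 0 else 0 <= v j 0 - v i 0.
Proof.
have E (j : 'I_m) : (if (i <= j)%N then 0 < v j 0 - v i 0 else 0 <= v j 0 - v i 0) =
    ~~ ((v j 0 < v i 0) || ((v j 0 == v i 0) && (i <= j)%N)).
  rewrite subr_gt0 subr_ge0; case: (i <= j)%N; last by rewrite andbF orbF -leNgt.
  by rewrite andbT orbC -le_eqVlt -ltNge.
rewrite classifyP; split=> [/existsNP[j /negP jn]|[j jn] H]; first by exists j; rewrite E.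
by move: jn; rewrite E H.
Qed.

Variable n : nat.

Lemma continuous_network_diff (n1 : nat) (T : params R n n1 m) (i j : 'I_m) :
  continuous (fun x : 'cV[R]_n => network T x j 0 - network T x i 0).
Proof.
by move=> x; apply: continuousB; exact: continuous_network.
Qed.

Lemma measurable_misclassified (n1 : nat) (T : params R n n1 m) (i : 'I_m) :
  measurable ([set x | classify (network T x) <> Some i] : set (borelRn R n)).
Proof.
have -> : [set x | classify (network T x) <> Some i] =
    \bigcup_(j in [set: 'I_m]) [set x | if (i <= j)%N
      then 0 < network T x j 0 - network T x i 0
      else 0 <= network T x j 0 - network T x i 0].
  apply/seteqP; split=> x /=; first by move/classify_neqP => [j H]; exists j.
  by move=> [j _ H]; apply/classify_neqP; exists j.
apply: fin_bigcup_measurable; first exact: finite_finset.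
move=> j _; have hc := @continuous_network_diff n1 T i j.
case: (i <= j)%N; first exact: (measurable_gt 0 hc).
exact: (measurable_ge 0 hc).
Qed.

Lemma measurable_exists_misclassified (n1 : nat) (T : params R n n1 m)
    (i : 'I_m) (r : R) : 0 <= r ->
  measurable ([set x | exists2 x', Sinf x r x' & classify (network T x') <> Some i]
    : set (borelRn R n)).
Proof.
move=> r0.
have -> : [set x | exists2 x', Sinf x r x' & classify (network T x') <> Some i] =
    \bigcup_(j in [set: 'I_m]) [set x | exists2 x', Sinf x r x' & if (i <= j)%N
      then 0 < network T x' j 0 - network T x' i 0
      else 0 <= network T x' j 0 - network T x' i 0].
  apply/seteqP; split=> x /=.
    by move=> [x' xx' /classify_neqP [j H]]; exists j => //; exists x'.
  by move=> [j _ [x' xx' H]]; exists x' => //; apply/classify_neqP; exists j.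
apply: fin_bigcup_measurable; first exact: finite_finset.
move=> j _; have hc := @continuous_network_diff n1 T i j.
case: (i <= j)%N; first exact: (measurable_exists_gt r 0 hc).
exact: (measurable_exists_ge 0 r0 hc).
Qed.

Variable l : 'cV[R]_n -> 'I_m.
Hypothesis l_meas :
  forall i : 'I_m, measurable ([set x | l x = i] : set (borelRn R n)).

Lemma measurable_correct (n1 : nat) (T : params R n n1 m) :
  measurable ([set x | classify (network T x) = Some (l x)] : set (borelRn R n)).
Proof.
have -> : [set x | classify (network T x) = Some (l x)] =
    \bigcup_(i in [set: 'I_m])
      ([set x | l x = i] `\` [set x | classify (network T x) <> Some i]).
  apply/seteqP; split=> x /=; first by move=> H; exists (l x) => //; split=> //; apply.
  by move=> [i _ [<- /contrapT]].
apply: fin_bigcup_measurable; first exact: finite_finset.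
by move=> i _; apply: measurableD; [exact: l_meas|exact: measurable_misclassified].
Qed.

(** Splitting by the value of the true label fixes the output to be beaten. The event is then a
    finite union, which allows the union bound on the two perturbed networks. *)
Lemma measurable_adversarial (n1 : nat) (T : params R n n1 m) (r : R) : 0 <= r ->
  measurable ([set x | exists x', adversarial_sample l (network T) r x x']
    : set (borelRn R n)).
Proof.
move=> r0.
have -> : [set x | exists x', adversarial_sample l (network T) r x x'] =
    \bigcup_(i in [set: 'I_m]) ([set x | l x = i] `&`
      [set x | exists2 x', Sinf x r x' & classify (network T x') <> Some i]).
  apply/seteqP; split=> x /=.
    by move=> [x' [xx' H]]; exists (l x) => //; split=> //; exists x'.
  by move=> [i _ [<- [x' xx' H]]]; exists x'.
apply: fin_bigcup_measurable; first exact: finite_finset.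
move=> i _; apply: measurableI; first exact: l_meas.
exact: measurable_exists_misclassified.
Qed.

End Classification.

(** * Normalised linear forms vanishing on a subspace *)

Section OrthogonalRows.

(** Outside column [i], row [i] of the new minor is zero, so the expansion along it has one term,
    whose cofactor is the determinant of an identity matrix. *)
Lemma det_replace_col (R : comNzRingType) (m n : nat) (V : 'M[R]_(m, n))
    (f : 'I_m -> 'I_n) (i : 'I_m) (k : 'I_n) :
  colsub f V = 1%:M ->
  \det (colsub (fun j => if j == i then k else f j) V) = V i k.
Proof.
move=> fV.
have fVE (p q : 'I_m) : V p (f q) = (p == q)%:R.
  by move/matrixP/(_ p q): fV; rewrite !mxE.
set B := colsub _ V.
rewrite (expand_det_row B i) (bigD1 i) //= big1 ?addr0 => [|j ji]; last first.
  by rewrite !mxE (negbTE ji) fVE eq_sym (negbTE ji) mul0r.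
rewrite mxE eqxx /cofactor -signr_odd addnn odd_double expr0 mul1r.
suff -> : row' i (col' i B) = 1%:M by rewrite det1 mulr1.
apply/matrixP => p q; rewrite !mxE eq_sym (negbTE (neq_lift i q)) fVE.
by rewrite (inj_eq (@lift_inj _ i)).
Qed.

(* The minor [f] maximises the absolute value of the determinant; by Cramer's
   rule the entries of [U *m V] are quotients of minors by that one. *)
Lemma bounded_row_basis (R : realFieldType) (m n : nat) (V : 'M[R]_(m, n)) :
  row_free V ->
  exists2 U : 'M[R]_m, U \in unitmx &
  exists2 f : 'I_m -> 'I_n, colsub f (U *m V) = 1%:M &
    forall i k, `|(U *m V) i k| <= 1.
Proof.
move=> Vfree.
have [f0 f0P] : exists f0 : {ffun 'I_m -> 'I_n}, \det (colsub f0 V) != 0.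
  have VTfull : row_full V^T by rewrite /row_full mxrank_tr; exact: Vfree.
  exists [ffun j => fullrankfun VTfull j].
  have := fullrowsub_unit VTfull; rewrite unitmxE unitfE -det_tr.
  suff -> : (rowsub (fullrankfun VTfull) V^T)^T =
     colsub [ffun j => fullrankfun VTfull j] V by [].
  by apply/matrixP => i j; rewrite !mxE ffunE.
pose f := [arg max_(g > f0) `|\det (colsub (g : {ffun 'I_m -> 'I_n}) V)|]%O.
have fmax (g : {ffun 'I_m -> 'I_n}) :
    `|\det (colsub g V)| <= `|\det (colsub f V)|.
  by rewrite /f; case: Order.TotalTheory.arg_maxP => // h _; apply.
have fgt0 : 0 < `|\det (colsub f V)|.
  by rewrite (lt_le_trans _ (fmax f0)) // normr_gt0.
have fU : colsub f V \in unitmx by rewrite unitmxE unitfE -normr_gt0.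
pose U := invmx (colsub f V).
have UV : colsub f (U *m V) = 1%:M by rewrite -mulmx_colsub mulVmx.
exists U; first by rewrite unitmx_inv.
exists f => // i k.
rewrite -(det_replace_col i k UV) -mulmx_colsub det_mulmx det_inv.
rewrite normrM normfV mulrC ler_pdivrMr // mul1r.
have := fmax [ffun j => if j == i then k else f j].
by congr (`|\det _| <= _); apply/matrixP => p q; rewrite !mxE ffunE.
Qed.

(** The forms are the first [m] rows of a basis of the left kernel of [B], whose columns form a
    basis of [W]; that kernel has rank at least [n - \dim W]. *)
Lemma row_free_annihilator (F : fieldType) (m n : nat) (W : {vspace 'cV[F]_n}) :
  (m + \dim W <= n)%N ->
  exists2 V : 'M[F]_(m, n), row_free V & forall x, x \in W -> V *m x = 0.
Proof.
move=> mW.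
pose B : 'M[F]_(n, \dim W) := \matrix_(i, j) (vbasis W)`_j i 0.
have mK : (m <= \rank (kermx B))%N.
  rewrite mxrank_ker; have := rank_leq_col B; lia.
pose V := pid_mx m *m row_base (kermx B) : 'M[F]_(m, n).
exists V.
  rewrite /row_free /V mxrankMfree ?row_base_free // rank_pid_mx //.
have VB : V *m B = 0.
  rewrite /V -mulmxA; suff -> : row_base (kermx B) *m B = 0 by rewrite mulmx0.
  by apply/sub_kermxP; rewrite eq_row_base.
move=> x /(coord_vbasis) ->.
rewrite mulmx_sumr big1 // => j _; rewrite -scalemxAr.
suff -> : V *m (vbasis W)`_j = 0 by rewrite scaler0.
have -> : (vbasis W)`_j = col j B by apply/colP => i; rewrite !mxE.
by rewrite colE mulmxA VB mul0mx.
Qed.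

End OrthogonalRows.

(** * Output gain from shifted pre-activations *)

Section Gain.
Variable R : realType.

(** Relu is monotone and the shift has the sign of [w], so no neuron, active or not, can reduce the
    gain. *)
Lemma relu_gain_ge0 (w z t : R) : 0 <= t ->
  0 <= w * (Num.max (z + t * Num.sg w) 0 - Num.max z 0).
Proof.
move=> t0; case: (ltrgt0P w) => [w0|w0|->]; last by rewrite mul0r.
- rewrite gtr0_sg // mulr1 pmulr_rge0 // subr_ge0.
  by rewrite ge_max !le_max lexx orbT lerDl t0.
- rewrite ltr0_sg // mulrN1 nmulr_rge0 // subr_le0.
  by rewrite ge_max !le_max lexx orbT gerBl t0.
Qed.

(** For [w > 0] the activation rises by exactly [t]. For [w < 0] it falls, but Relu stops it at 0;
    starting above [b], it still falls by at least the minimum of [t] and [b]. *)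
Lemma relu_gain_ge (c w b z t : R) : 0 < b -> 0 < c -> 0 < t -> c < `|w| -> b < z ->
  c * Num.min t b <= w * (Num.max (z + t * Num.sg w) 0 - Num.max z 0).
Proof.
move=> b0 c0 t0 cw bz.
rewrite (max_l (x := z)); last by lra.
have m0 : 0 < Num.min t b by rewrite lt_min t0.
have mt : Num.min t b <= t by rewrite ge_min lexx.
have mb : Num.min t b <= b by rewrite ge_min lexx orbT.
apply: (@le_trans _ _ (`|w| * Num.min t b)); first by rewrite ler_pM2r // ltW.
case: (ltrgt0P w) cw => [w0|w0|->] cw; last by lra.
- rewrite gtr0_sg // mulr1 ler_pM2l // max_l; last by lra.
  by rewrite addrC addKr.
- rewrite ltr0_sg // mulrN1 mulNr -mulrN ler_nM2l // lerBlDr ge_max.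
  by apply/andP; split; lra.
Qed.

Lemma norm_minf_gt (k : nat) (v : 'rV[R]_k) (c : R) (i : 'I_k) :
  (c%:E < norm_minf v)%E -> c < `|v 0 i|.
Proof. by move=> /bigmin_gtP[_ /(_ i isT)]; rewrite lte_fin. Qed.

Lemma networkB (n n1 m : nat) (T : params R n n1 m) (x : 'cV[R]_n) (i j : 'I_m) :
  network T x j 0 - network T x i 0 =
  \sum_k (W2 T j k - W2 T i k) * hidden T x k 0 + (b2 T j 0 - b2 T i 0).
Proof.
rewrite !mxE opprD addrACA -sumrB; congr (_ + _).
by apply: eq_bigr => k _; rewrite mulrBl.
Qed.

(** Output [j] trails output [i] by less than [A] before the shift; the neurons above [b] alone
    contribute a gain of at least [A], and the others contribute nonnegatively. *)
Lemma misclassified_of_gain (n n1 m : nat) (T T' : params R n n1 m)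
    (y : 'cV[R]_n) (i j : 'I_m) (A b c t : R) :
  0 < b -> 0 < c -> 0 < t ->
  W2 T' = W2 T -> b2 T' = b2 T ->
  (forall k, (W1 T' *m y + b1 T') k 0 =
     (W1 T *m y + b1 T) k 0 + t * Num.sg (W2 T j k - W2 T i k)) ->
  (forall k, c < `|W2 T j k - W2 T i k|) ->
  `|network T y j 0 - network T y i 0| < A ->
  A <= c * Num.min t b * #|[pred k | b < (W1 T *m y + b1 T) k 0]|%:R ->
  classify (network T' y) <> Some i.
Proof.
move=> b0 c0 t0 W2E b2E preE cW FA AK; apply: (@classify_neq _ _ _ _ j).
rewrite -subr_gt0 networkB W2E b2E.
pose g k := (W2 T j k - W2 T i k) * (hidden T' y k 0 - hidden T y k 0).
have gE k : g k = (W2 T j k - W2 T i k) *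
    (Num.max ((W1 T *m y + b1 T) k 0 + t * Num.sg (W2 T j k - W2 T i k)) 0 -
     Num.max ((W1 T *m y + b1 T) k 0) 0).
  by rewrite -preE /g /hidden /relu !mxE.
have -> : \sum_k (W2 T j k - W2 T i k) * hidden T' y k 0 + (b2 T j 0 - b2 T i 0) =
    (network T y j 0 - network T y i 0) + \sum_k g k.
  rewrite networkB addrAC -big_split /=; congr (_ + _).
  by apply: eq_bigr => k _; rewrite /g; ring.
have gA : A <= \sum_k g k.
  apply: (le_trans AK); rewrite mulrC mulr_natl.
  rewrite (bigID [pred k | b < (W1 T *m y + b1 T) k 0]) /=.
  apply: ler_wpDr.
    by apply: sumr_ge0 => k _; rewrite gE; exact/relu_gain_ge0/ltW.
  rewrite -sumr_const; apply: ler_sum => k bk; rewrite gE.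
  exact: relu_gain_ge.
by move: FA; rewrite ltr_norml; lra.
Qed.

(** If an average exceeds [b], so does one of the two terms. *)
Lemma card_active_split (n1 : nat) (u v w : 'cV[R]_n1) (b : R) :
  (forall k, u k 0 + v k 0 = 2 * w k 0) ->
  (#|[pred k | (b < w k 0)%R]| <=
   #|[pred k | (b < u k 0)%R]| + #|[pred k | (b < v k 0)%R]|)%N.
Proof.
move=> uvw; rewrite -cardUI; apply: leq_trans (leq_addr _ _).
apply/subset_leq_card/fintype.subsetP => k; rewrite !inE => bw.
by have := uvw k; case: ltP => //= ub; move: bw => *; lra.
Qed.

End Gain.

(** * Probability bounds from almost sure inclusions *)

Lemma half_le_measure (d : measure_display) (T : measurableType d) (R : realType)
    (P : probability T R) (S A B : set T) :
  {ae P, forall x, S x} -> measurable A -> measurable B -> S `<=` A `|` B ->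
  ((2^-1)%:E <= P A)%E \/ ((2^-1)%:E <= P B)%E.
Proof.
move=> [N [mN N0 SN]] mA mB SAB.
have H : (1 <= P A + P B)%E.
  rewrite -(probability_setT P) -[leRHS]adde0 -N0.
  have mAB : measurable (A `|` B) by exact: measurableU.
  (* [S] itself carries no measurability assumption; the null set [N] contains its complement, so
     adding [N] covers the whole space at no cost. *)
  apply: (@le_trans _ _ (P ((A `|` B) `|` N))).
    apply: le_measure; rewrite ?inE //; first exact: measurableU.
    move=> x _; have [/SAB|nS] := pselect (S x); first by left.
    by right; apply: SN.
  apply: (le_trans (measureU2 P mAB mN)); apply: leeD => //.
  exact: measureU2.
move: H; rewrite -(fineK (fin_num_measure P A mA)) -(fineK (fin_num_measure P B mB)).
rewrite -EFinD !lee_fin => H.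
by have [|] := lerP 2^-1 (fine (P A)); [left|right; lra].
Qed.

Lemma le_measure_ae (d : measure_display) (T : measurableType d) (R : realType)
    (P : probability T R) (S A B : set T) :
  {ae P, forall x, S x} -> measurable A -> measurable B ->
  (forall x, S x -> A x -> B x) -> (P A <= P B)%E.
Proof.
move=> [N [mN N0 SN]] mA mB SAB.
rewrite -[leRHS]adde0 -N0; apply: le_trans (measureU2 P mB mN).
apply: le_measure; rewrite ?inE //; first exact: measurableU.
move=> x Ax; have [Sx|nS] := pselect (S x); first by left; exact: SAB.
by right; apply: SN.
Qed.

(** * Perturbations of the first layer and their effect on pre-activations *)

Section SignedPerturbation.
Variables (R : realType) (n n1 m : nat) (T : params R n n1 m).

Definition perturb (s : R) (M : 'M[R]_(n1, n)) : params R n n1 m :=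
  Params (W1 T + s *: M) (b1 T) (W2 T) (b2 T).

Lemma network_perturb_ker (s : R) (M : 'M[R]_(n1, n)) (x : 'cV[R]_n) :
  M *m x = 0 -> network (perturb s M) x = network T x.
Proof.
by move=> Mx; rewrite /network /hidden /= mulmxDl -scalemxAl Mx scaler0 addr0.
Qed.

Lemma perturb_near (s gamma : R) (M : 'M[R]_(n1, n)) : 0 < gamma -> `|s| = 1 ->
  (forall k j, `|M k j| < gamma) -> param_near gamma T (perturb s M).
Proof.
move=> g0 s1 Mg; split=> [i j|i|i j|i] /=; rewrite ?subrr ?normr0 //.
by rewrite !mxE addrAC subrr add0r normrM s1 mul1r.
Qed.

Variable o : 'I_m -> 'I_m.

(* Column [i] pushes every neuron so that the output [o i] gains on [i]. *)
Definition push : 'M[R]_(n1, m) :=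
  \matrix_(k, i) Num.sg (W2 T (o i) k - W2 T i k).

(** A sum of [m] products of factors bounded by 1: this is where the factor [m] in the lower bound
    on [n1] comes from. *)
Lemma push_mul_norm_le (V : 'M[R]_(m, n)) (k : 'I_n1) (j : 'I_n) :
  (forall p q, `|V p q| <= 1) -> `|(push *m V) k j| <= m%:R.
Proof.
move=> V1; rewrite mxE; apply: le_trans (ler_norm_sum _ _ _) _.
rewrite (_ : m%:R = \sum_(i < m) 1); last by rewrite sumr_const card_ord.
apply: ler_sum => i _; rewrite normrM mxE -[leRHS]mul1r.
by apply: ler_pM => //; rewrite normr_sg lern1 leq_b1.
Qed.

(** By duality [V *m y] is [s * eps] times the [i]-th unit vector, so only column [i] of [push]
    acts. The sign [s] occurs both in the perturbation and in the step to [y], and cancels: both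
    signs push in the same direction. *)
Lemma perturb_preactivation (V : 'M[R]_(m, n)) (f : 'I_m -> 'I_n)
    (x : 'cV[R]_n) (s tau eps : R) (i : 'I_m) (k : 'I_n1) :
  s * s = 1 -> V *m x = 0 -> colsub f V = 1%:M ->
  let y := x + (s * eps) *: delta_mx (f i) 0 in
  (W1 (perturb s (tau *: (push *m V))) *m y + b1 T) k 0 =
  (W1 T *m y + b1 T) k 0 + tau * eps * Num.sg (W2 T (o i) k - W2 T i k).
Proof.
move=> ss Vx fV y.
have Vy : V *m y = (s * eps) *: delta_mx i 0.
  rewrite mulmxDr Vx add0r -scalemxAr; congr (_ *: _).
  apply/colP => p; rewrite -colE !mxE eqxx andbT.
  by move/matrixP/(_ p i) : fV; rewrite !mxE.
rewrite /= mulmxDl -!scalemxAl -mulmxA Vy -scalemxAr -colE.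
rewrite addrAC !scalerA mxE; congr (_ + _); rewrite !mxE; congr (_ * _).
by rewrite mulrACA -[RHS]mulr1 -ss; ring.
Qed.

End SignedPerturbation.

(** * Choice of the perturbation and of its sign *)

Theorem theorem4p2 (R : realType) (n n1 m : nat) (m_ge2 : (2 <= m)%N)
    (Theta : params R n n1 m)
    (S : set 'cV[R]_n)
    (S_cube : forall x, S x -> forall i, 0 <= x i 0 <= 1)
    (D : probability (borelRn R n) R)
    (D_supp : {ae D, forall x, S x})
    (l : 'cV[R]_n -> 'I_m)
    (l_meas : forall i : 'I_m, measurable ([set x | l x = i] : set (borelRn R n)))
    (a A b c eta : R)
    (a_gt0 : 0 < a) (A_gt0 : 0 < A) (b_gt0 : 0 < b) (c_gt0 : 0 < c)
    (eta_01 : 0 < eta < 1)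
    (C1 : forall x, (\bigcup_(x0 in S) Sinf x0 a) x -> forall i j : 'I_m,
      `|network Theta x i 0 - network Theta x j 0| < A)
    (C2 : forall i j : 'I_m, i != j ->
      (c%:E < norm_minf (row i (W2 Theta) - row j (W2 Theta)))%E)
    (C3 : forall x, S x ->
      eta * n1%:R <= #|[pred k : 'I_n1 | b < `|hidden Theta x k 0| ]|%:R)
    (C4 : (\dim (linear_span S) < n - m)%N)
    (eps gamma : R) (eps_gt0 : 0 < eps) (gamma_gt0 : 0 < gamma)
    (eps_lt_a : eps < a)
    (n1_large : 2 * A / (Num.min (eps * gamma / m%:R) b * c * eta) < n1%:R) :
  exists2 G : 'cV[R]_n -> 'cV[R]_m, Hgamma gamma Theta G &
    (accuracy D l (network Theta) <= accuracy D l G)%E /\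
    ((2^-1)%:E <= D [set x | exists x', adversarial_sample l G eps x x'])%E.
Proof.
have [eta_gt0 _] := andP eta_01.
have m_gt0 : 0 < m%:R :> R by rewrite ltr0n; apply: leq_trans m_ge2.
have q0_gt0 : 0 < Num.min (eps * gamma / m%:R) b.
  by rewrite lt_min b_gt0 andbT divr_gt0 // mulr_gt0.
have n1_gt0 : 0 < n1%:R :> R.
  by apply: le_lt_trans n1_large; rewrite divr_ge0 ?mulr_ge0 // ltW.
(* Chosen so that [eta * n1 / 2] neurons, each gaining [c * t], yield exactly [A]; the lower bound
   on [n1] then says that [t] is below both [eps * gamma / m] and [b]. *)
pose t := 2 * A / (c * eta * n1%:R).
have t_gt0 : 0 < t by rewrite divr_gt0 ?mulr_gt0.
have tE : c * t * (eta * n1%:R) = 2 * A.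
  by rewrite /t; field; rewrite !gt_eqF.
have tq : t < Num.min (eps * gamma / m%:R) b.
  move: n1_large; rewrite ltr_pdivrMr ?mulr_gt0 // => H.
  by rewrite ltr_pdivrMr ?mulr_gt0 // (lt_le_trans H) //; lra.
have [tg tb] : t < eps * gamma / m%:R /\ t < b.
  by apply/andP; rewrite -lt_min.
have [other oP] : exists o : 'I_m -> 'I_m, forall i, i != o i.
  have m0 : (0 < m)%N by apply: leq_trans m_ge2.
  exists (fun i => if i == Ordinal m0 then Ordinal m_ge2 else Ordinal m0) => i.
  by case: (eqVneq i (Ordinal m0)) => [->|].
have [V0 V0free V0S] : exists2 V : 'M[R]_(m, n), row_free V &
    forall x, x \in linear_span S -> V *m x = 0.
  (* The subtraction in [C4] is truncated, but the strict inequality still gives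
     [m + \dim (linear_span S) < n]. *)
  by apply: row_free_annihilator; rewrite ltnW // -ltn_subRL.
have [U _ [f fV V1]] := bounded_row_basis V0free.
set V := U *m V0 in fV V1.
have VS x : S x -> V *m x = 0.
  by move=> Sx; rewrite /V -mulmxA V0S ?mulmx0 //; exact: (linear_spanP S).1.
have te_gt0 : 0 < t / eps by exact: divr_gt0.
(* A step of length [eps] is thus turned into a shift of [t], and entries stay within
   [m * t / eps < gamma]. *)
pose M := (t / eps) *: (push Theta other *m V).
pose G s := network (perturb Theta s M).
have MS x : S x -> M *m x = 0.
  by move=> Sx; rewrite /M -scalemxAl -mulmxA VS // mulmx0 scaler0.
have Mgamma k j : `|M k j| < gamma.
  rewrite mxE normrM (gtr0_norm te_gt0).
  apply: (@le_lt_trans _ _ (t / eps * m%:R)).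
    by rewrite (ler_pM2l te_gt0); exact: push_mul_norm_le.
  by rewrite mulrAC ltr_pdivrMr // -ltr_pdivlMr // (mulrC gamma).
have G_near s : `|s| = 1 -> Hgamma gamma Theta (G s).
  by move=> s1; exists (perturb Theta s M) => //; exact: perturb_near.
have G_acc s : (accuracy D l (network Theta) <= accuracy D l (G s))%E.
  apply: (le_measure_ae D_supp); try exact: measurable_correct.
  by move=> x Sx /=; rewrite /G network_perturb_ker // MS.
pose Adv s := [set x | exists x', adversarial_sample l (G s) eps x x'].
have Adv_meas s : measurable (Adv s : set (borelRn R n)).
  by apply: measurable_adversarial => //; exact: ltW.
have Adv_active s x : S x -> `|s| = 1 -> s * s = 1 ->
    let y := x + (s * eps) *: delta_mx (f (l x)) 0 in
    eta * n1%:R <= 2 * #|[pred k | b < (W1 Theta *m y + b1 Theta) k 0]|%:R ->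
    Adv s x.
  move=> Sx s1 ss y Ky.
  have xy : Sinf x eps y.
    move=> i; rewrite /y !mxE addrAC subrr add0r normrM normrM s1 mul1r gtr0_norm //.
    by case: (_ && _); rewrite ?normr1 ?normr0 ?mulr1 ?mulr0 // ltW.
  exists y; split=> //.
  apply: (@misclassified_of_gain _ _ _ _ Theta _ y (l x) (other (l x)) A b c t) => //.
  - move=> k; rewrite perturb_preactivation ?VS // divfK // gt_eqF //.
  - by move=> k; have := norm_minf_gt k (C2 _ _ (oP (l x))); rewrite !mxE distrC.
  - by apply: C1; exists x => // i; apply: le_trans (xy i) (ltW _).
  - rewrite (min_l (ltW tb)).
    have := ler_wpM2l (ltW (mulr_gt0 c_gt0 t_gt0)) Ky; rewrite tE; lra.
have S_Adv : S `<=` Adv 1 `|` Adv (-1).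
  move=> x Sx.
  pose e : 'cV[R]_n := delta_mx (f (l x)) 0.
  pose pre s := W1 Theta *m (x + (s * eps) *: e) + b1 Theta.
  (* As [b > 0], activity can be read on the pre-activations; these are affine, so their values at
     [x] are the averages of those at the two opposite points. *)
  have hE : #|[pred k : 'I_n1 | b < `|hidden Theta x k 0| ]| =
      #|[pred k | b < (W1 Theta *m x + b1 Theta) k 0]|.
    apply: eq_card => k; rewrite !inE /hidden /relu mxE ger0_norm ?le_max ?lexx ?orbT //.
    by rewrite lt_max (lt_gtF b_gt0) orbF.
  have preE k : pre 1 k 0 + pre (-1) k 0 = 2 * (W1 Theta *m x + b1 Theta) k 0.
    rewrite /pre !mulmxDr -!scalemxAr !mxE; ring.
  have := C3 _ Sx; rewrite hE => K.
  have := card_active_split b preE; rewrite -(ler_nat R) natrD => K'.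
  (* If fewer than [eta * n1 / 2] neurons exceed [b] at the first point, more than that many do at
     the opposite one. *)
  have [H|H] := lerP (eta * n1%:R) (2 * #|[pred k | b < pre 1 k 0]|%:R).
    by left; apply: Adv_active; rewrite ?normr1 ?mulr1.
  right; apply: Adv_active; rewrite ?normrN ?normr1 ?mulrNN ?mulr1 //.
  rewrite -/e -/(pre (-1)); lra.
have [H|H] := half_le_measure D_supp (Adv_meas 1) (Adv_meas (-1)) S_Adv.
  by exists (G 1); [apply: G_near; rewrite normr1|split].
by exists (G (-1)); [apply: G_near; rewrite normrN normr1|split].
Qed.
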